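(* Let $(r_i)_{i\in\mathbb Z}$ be a sequence of nonnegative integers. For integers $i\le j$ define $r^{(i)}_j$ by $$r^{(j)}_j=r_j,\qquad r^{(i-1)}_j=r^{(i)}_j+\mathbf 1\bigl(r^{(i)}_j\ge r_{i-1}\bigr),$$ and put $$\ell_j=\sum_{i<j}\mathbf 1\bigl(r^{(i)}_j<r_i\bigr)\in\{0,1,2,\dots\}\cup\{\infty\},\qquad j\in\mathbb Z.$$ Then $(r_i)_{i\in\mathbb Z}$ occurs as the sequence of right inversion counts of some balanced permutation $\sigma$ of $\mathbb Z$ if and only if the following two conditions hold: (i) $\ell_i<\infty$ for all $i\in\mathbb Z$; (ii) $r_i=0$ for infinitely many $i\ge1$. Under these conditions such a balanced permutation $\sigma$ is unique, and it has left inversion counts $(\ell_i)_{i\in\mathbb Z}$.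
   Context: A permutation of $\mathbb Z$ is a bijection $\sigma:\mathbb Z\to\mathbb Z$. It is balanced if $\#\{j\ge 1:\sigma(j)\le 0\}=\#\{j\le 0:\sigma(j)\ge 1\}<\infty$. The right inversion count of $\sigma$ at $i$ is $\#\{j>i:\sigma(j)<\sigma(i)\}$, and the left inversion count of $\sigma$ at $i$ is $\#\{j<i:\sigma(j)>\sigma(i)\}$. $\mathbf 1(\cdot)$ is $1$ if the condition holds and $0$ otherwise. *)

(* Defs.v *)
From mathcomp Require Import all_boot all_order all_algebra.
From mathcomp Require Import all_classical all_reals all_analysis.
From mathcomp Require Import zify.
Set Implicit Arguments.
Unset Strict Implicit.
Unset Printing Implicit Defensive.
Import Order.TTheory GRing.Theory Num.Theory.
Local Open Scope classical_set_scope.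
Local Open Scope ring_scope.

Definition balanced_permutation (s : int -> int) : Prop :=
  [/\ bijective s,
      ([set j : int | 1 <= j /\ s j <= 0] #= [set j : int | j <= 0 /\ 1 <= s j])%card
    & finite_set [set j : int | 1 <= j /\ s j <= 0]].

(* Counts live in \bar R, so that they may be infinite; [R] is used only as a
   carrier for the values in {0, 1, 2, ...} \cup {+oo}. *)
Definition right_inversion_count (R : realType) (s : int -> int) (i : int)
    : \bar R :=
  counting [set j : int | i < j /\ s j < s i].

Definition left_inversion_count (R : realType) (s : int -> int) (i : int)
    : \bar R :=
  counting [set j : int | j < i /\ s i < s j].

(* [lift_down r j k] is r^{(j-k)}_j. *)
Fixpoint lift_down (r : int -> nat) (j : int) (k : nat) : nat :=
  if k is k'.+1 then
    (lift_down r j k' + (r (j - k'.+1%:Z)%R <= lift_down r j k'))%N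
  else r j.

(* [lifted r i j] is r^{(i)}_j; it is meaningful only for i <= j. *)
Definition lifted (r : int -> nat) (i j : int) : nat :=
  lift_down r j `|j - i|%N.

Lemma lifted_diag (r : int -> nat) (j : int) : lifted r j j = r j.
Proof. by rewrite /lifted subrr. Qed.

Lemma lifted_pred (r : int -> nat) (i j : int) : i <= j ->
  lifted r (i - 1) j = (lifted r i j + (r (i - 1)%R <= lifted r i j))%N.
Proof.
move=> le_ij; rewrite /lifted.
have -> : `|j - (i - 1)%R|%N = `|j - i|%N.+1 by lia.
by rewrite /=; have -> : j - `|j - i|%N.+1%:Z = i - 1 by lia.
Qed.

Definition ell (R : realType) (r : int -> nat) (j : int) : \bar R :=
  \esum_(i in [set i : int | i < j]) ((lifted r i j < r i)%N%:R)%:E.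

(* Main.v *)
Require Import Defs.
From mathcomp Require Import all_boot all_order all_algebra finmap.
From mathcomp Require Import all_classical all_reals all_analysis.
From mathcomp Require Import zify.
Set Implicit Arguments.
Unset Strict Implicit.
Unset Printing Implicit Defensive.
Import Order.TTheory GRing.Theory Num.Theory.
Local Open Scope classical_set_scope.
Local Open Scope ring_scope.

(** Write [phi i j] for [lifted r i j], where [i <= j].

    If [s] is injective with right inversion counts [r], then [phi i j] is the
    rank of [s j] among the values [s k], [k >= i]: the value [s (i - 1)] enters
    the picture with rank [r (i - 1)], and it pushes [s j] up by one exactly when
    that rank is at most the rank of [s j] ([card_window_lifted]).  So [r]
    determines the relative order of the values of [s].  If moreover [s] is
    balanced, then for [i] so small that every [k < i] has [s k < v], exactly
    [v - i] indices [k >= i] have [s k < v] ([balanced_card_window]).  Taking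
    [v = s j] gives [s j = i + phi i j] for all sufficiently small [i].  In other
    words [s j] is the eventual value of [i + phi i j] as [i] tends to -oo, which
    proves uniqueness.

    Conversely, [i + phi i j] does not change from [i + 1] to [i] precisely when
    [r i <= phi i j], so this sequence stabilises precisely when [ell j] is
    finite, and one may define [s j] as its limit ([lifted_limit]).  Everything
    about [s] is then read off from the ranks.  The lift preserves the order, so
    [s j < s k] is equivalent to [phi i j < phi i k] for any [i] below both
    indices; in particular [ell] counts the left inversions of [s].  The
    infinitely many zeros of [r] make [phi i] a bijection from the indices
    [k >= i] onto the natural numbers ([lifted_surj]): a value looked for at [i]
    is looked for, possibly lowered by one, at [i + 1], and every zero of [r]
    either hits it or lowers it.  This gives the right inversion counts, the
    surjectivity of [s], and the number of elements of the window that expresses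
    balance.

    Condition (ii) is necessary because following right inversions strictly
    decreases [r], hence ends at a zero arbitrarily far to the right; condition
    (i) is necessary because the left inversions of a balanced permutation at
    any index lie in a bounded interval. *)

(** * Finite cardinalities and counting *)

Lemma card_eqI_inj (T : Type) (A : set T) (n m : nat) :
  (A #= `I_n)%card -> (A #= `I_m)%card -> n = m.
Proof.
by move=> An Am; apply/card_eq_II; apply: card_eq_trans Am; rewrite card_eq_sym.
Qed.

Lemma card_eqI_finite (T : Type) (A : set T) (n : nat) :
  (A #= `I_n)%card -> finite_set A.
Proof. by move=> An; apply/finite_setP; exists n. Qed.

Lemma card_eqI_setU (T : choiceType) (A B : set T) (n m : nat) :
  (A #= `I_n)%card -> (B #= `I_m)%card -> (forall x, A x -> B x -> False) ->
  (A `|` B #= `I_(n + m))%card.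
Proof.
move=> An Bm AB.
have fA := card_eqI_finite An; have fB := card_eqI_finite Bm.
have -> : A `|` B = [set` (fset_set A `|` fset_set B)%fset].
  by rewrite -fset_setU// fset_setK// finite_setU.
apply/card_eq_fsetP; rewrite -(card_fset_set An) -(card_fset_set Bm).
rewrite cardfsU -fset_setI// [A `&` B](_ : _ = set0) ?fset_set0 ?cardfs0 ?subn0//.
by rewrite -subset0 => x [Ax Bx]; exact: (AB x).
Qed.

Lemma card_eqI_sub (T : Type) (A B : set T) (n m : nat) :
  (A #= `I_n)%card -> (B #= `I_m)%card -> A `<=` B -> (n <= m)%N.
Proof.
move=> An Bm AB; rewrite -card_le_II -(card_le_eql An) -(card_le_eqr Bm).
exact: subset_card_le.
Qed.

Lemma card_eqI_proper (T : choiceType) (A B : set T) (x : T) (n m : nat) :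
  (A #= `I_n)%card -> (B #= `I_m)%card -> A `<=` B -> B x -> ~ A x -> (n < m)%N.
Proof.
move=> An Bm AB Bx nAx.
have Ax : (A `|` [set x] #= `I_(n + 1))%card.
  by apply: card_eqI_setU An card_set1 _ => y Ay /= yx; apply: nAx; rewrite -yx.
rewrite -addn1; apply: card_eqI_sub Ax Bm _.
by move=> y [/AB//|/= ->].
Qed.

Lemma card_int_interval (a b : int) : a <= b ->
  ([set k : int | a <= k /\ k < b] #= `I_(`|b - a|%N))%card.
Proof.
move=> ab; have -> : [set k : int | a <= k /\ k < b] =
    (fun n : nat => a + n%:Z) @` `I_(`|b - a|%N).
  apply/seteqP; split=> k /=; last by move=> [n nlt <-]; lia.
  by move=> kab; exists `|k - a|%N; lia.
by apply: inj_card_eq => m n _ _ /=; lia.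
Qed.

Lemma finite_int_bounded (A : set int) : finite_set A ->
  exists n : int, forall k, A k -> - n <= k /\ k <= n.
Proof.
move=> /finite_seqP[s ->]; elim: s => [|a s [n nP]]; first by exists 0.
exists (Num.max n `|a|) => k /=; rewrite inE => /orP[/eqP ->|/nP[]]; lia.
Qed.

Lemma bounded_int_finite (A : set int) (a b : int) :
  (forall k, A k -> a <= k /\ k < b) -> finite_set A.
Proof.
move=> Aab; have [ab|ba] := leP a b.
  exact: sub_finite_set Aab (card_eqI_finite (card_int_interval ab)).
rewrite [A](_ : _ = set0)// -subset0 => k /Aab; lia.
Qed.

Lemma countingE (R : realType) (T : choiceType) (A : set T) (n : nat) :
  counting A = n%:R%:E :> \bar R <-> (A #= `I_n)%card.
Proof.
rewrite /counting; split=> [|An].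
  case: ifPn => // /asboolP fA [/eqP]; rewrite eqr_nat => /eqP <-.
  by rewrite -{1}(fset_setK fA); apply/card_eq_fsetP.
by rewrite asboolT ?(card_fset_set An)//; exact: card_eqI_finite An.
Qed.

Lemma counting_ltey (R : realType) (T : choiceType) (A : set T) :
  (counting A < +oo :> \bar R)%E <-> finite_set A.
Proof.
rewrite /counting; case: ifPn => [/asboolP|/asboolP] fA; split=> //.
by rewrite ltry.
Qed.

Lemma counting_esum (R : realType) (T : choiceType) (A : set T) :
  counting A = \esum_(i in A) 1%E :> \bar R.
Proof.
rewrite /counting; case: ifPn => /asboolP fA.
  rewrite esum_fset// fsbig_finite//= card_fset_sum1 natr_sum -sumEFin.
  by [].
apply/esym/eqyP => x x0; have [B BA Bx] := infinite_set_fset (Num.truncn x).+1 fA.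
apply: esum_ge; exists [set` B] => //.
apply: (@le_trans _ _ (Num.truncn x).+1%:R%:E).
  by rewrite lee_fin ltW// truncnS_gt.
move: Bx; rewrite -(@ler_nat R) -lee_fin => /le_trans; apply.
by rewrite fsbig_finite//= card_fset_sum1 sumEFin natr_sum// set_fsetK.
Qed.

Lemma ell_counting (R : realType) (r : int -> nat) (j : int) :
  ell R r j = counting [set i : int | i < j /\ (lifted r i j < r i)%N].
Proof.
rewrite counting_esum /ell.
have -> : [set i : int | i < j /\ (lifted r i j < r i)%N] =
  [set i | i < j] `&` [set i | (lifted r i j < r i)%N] by [].
rewrite esum_mkcondr; apply: eq_esum => i _.
by case: ifPn => [/set_mem /= ->//|/negP h]; case: ltnP => // lt; case: h; exact/mem_set.
Qed.

(** * The lifting procedure *)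

Lemma liftedS (r : int -> nat) (i j : int) : i < j ->
  lifted r i j = (lifted r (i + 1) j + (r i <= lifted r (i + 1) j))%N.
Proof. by move=> ij; have := @lifted_pred r (i + 1) j; rewrite addrK; apply; lia. Qed.

(** Lifting past [r i] and comparing with [r i] commute: a value is raised only
    if it is already at least [r i]. *)
Lemma lifted_ge (r : int -> nat) (i j : int) : i < j ->
  (r i <= lifted r i j)%N = (r i <= lifted r (i + 1) j)%N.
Proof. by move=> ij; rewrite (liftedS r ij); case: leqP; lia. Qed.

(** The lift [x |-> x + (c <= x)] is strictly increasing, hence it both preserves
    and reflects the order. *)
Lemma lifted_le (r : int -> nat) (i i' j k : int) :
  i' <= i -> i <= j -> i <= k ->
  (lifted r i' j <= lifted r i' k)%N = (lifted r i j <= lifted r i k)%N.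
Proof.
move: {-2}(`|i - i'|%N) (erefl `|i - i'|%N) => n.
elim: n i' => [|n IHn] i' en ii' ij ik; first by have -> : i' = i by lia.
rewrite -(IHn (i' + 1)); try lia.
by rewrite !(@liftedS r i'); [case: leqP; case: leqP|..]; lia.
Qed.

Lemma lifted_lt (r : int -> nat) (i i' j k : int) :
  i' <= i -> i <= j -> i <= k ->
  (lifted r i' j < lifted r i' k)%N = (lifted r i j < lifted r i k)%N.
Proof. by move=> ii' ij ik; rewrite !ltnNge (lifted_le r ii'). Qed.

(** The lift past [r j] never takes the value [r j], so a later index is separated
    from [j] at stage [j], and by monotonicity at all earlier stages. *)
Lemma lifted_inj (r : int -> nat) (i j k : int) : i <= j -> i <= k ->
  lifted r i j = lifted r i k -> j = k.
Proof.
wlog jk : j k / j < k.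
  move=> wl ij ik e; have [jk|kj|//] := ltgtP j k; first exact: wl.
  by apply/esym/wl.
move=> ij ik e; exfalso.
have := @lifted_le r j i j k ij (lexx _) (ltW jk).
have := @lifted_le r j i k j ij (ltW jk) (lexx _).
by rewrite e leqnn lifted_diag (liftedS r jk); case: leqP; lia.
Qed.

(** The value [m] at stage [i] comes from [m] or [m.-1] at stage [i + 1], unless
    [m = r i].  A zero of [r] excludes the first case for [m > 0], so the outer
    induction is on [m] and the inner one on the distance to the next zero. *)
Lemma lifted_surj (r : int -> nat) :
  (forall i : int, exists2 z : int, i <= z & r z = 0%N) ->
  forall (m : nat) (i : int), exists2 j : int, i <= j & lifted r i j = m.
Proof.
move=> zeros; elim/ltn_ind => m IHm i; have [z] := zeros i.
move: {-2}(`|z - i|%N) (erefl `|z - i|%N) => n.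
elim: n i => [|n IHn] i en iz rz.
  have zi : z = i by lia.
  rewrite zi in rz; case: m IHm => [|m] IHm; first by exists i; rewrite ?lifted_diag.
  have [|j ij e] := IHm m _ (i + 1); first lia.
  by exists j; [lia|rewrite liftedS ?e ?rz; lia].
have [rm|mr|e] := ltngtP (r i) m; last by exists i; rewrite ?lifted_diag.
  have [|j ij e] := IHm m.-1 _ (i + 1); first lia.
  by exists j; [lia|rewrite liftedS ?e; lia].
have [j ij e] : exists2 j, i + 1 <= j & lifted r (i + 1) j = m.
  by apply: IHn rz; lia.
by exists j; [lia|rewrite liftedS ?e; lia].
Qed.

Lemma card_lifted (r : int -> nat) (i : int) (m : nat) :
  (forall i : int, exists2 z : int, i <= z & r z = 0%N) ->
  ([set k | i <= k /\ (lifted r i k < m)%N] #= `I_m)%card.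
Proof.
move=> zeros; rewrite card_eq_sym.
have -> : `I_m = lifted r i @` [set k | i <= k /\ (lifted r i k < m)%N].
  apply/seteqP; split=> [n /= nm|n /= [k [_ km] <-]//].
  by have [k ik e] := lifted_surj zeros n i; exists k; rewrite ?e.
by apply: inj_card_eq => j k /set_mem[ij _] /set_mem[ik _]; apply: lifted_inj.
Qed.

(** * Ranks and windows of a permutation *)

Definition window (s : int -> int) (i v : int) : set int :=
  [set k | i <= k /\ s k < v].

Definition right_counts (s : int -> int) (r : int -> nat) : Prop :=
  forall i, ([set j | i < j /\ s j < s i] #= `I_(r i))%card.

(** The rank of [s i] among the later values is [r i], and the rank of [s j] among
    them is [lifted r (i + 1) j]; comparing these two numbers decides whether
    [s i < s j], because the two windows are nested. *)
Lemma card_window_lifted (s : int -> int) (r : int -> nat) :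
  injective s -> right_counts s r ->
  forall i j : int, i <= j -> (window s i (s j) #= `I_(lifted r i j))%card.
Proof.
move=> s_inj sr i j.
move: {-2}(`|j - i|%N) (erefl `|j - i|%N) => n.
elim: n i => [|n IHn] i en ij.
  have -> : i = j by lia.
  rewrite lifted_diag [window _ _ _](_ : _ = [set k | j < k /\ s k < s j]) //.
  apply/seteqP; split=> k /= [jk skj]; split=> //; last exact: ltW.
  by rewrite lt_neqAle jk andbT; apply/eqP => e; rewrite e ltxx in skj.
have {IHn} cj : (window s (i + 1) (s j) #= `I_(lifted r (i + 1) j))%card.
  by apply: IHn; lia.
have ci : (window s (i + 1) (s i) #= `I_(r i))%card.
  rewrite [window _ _ _](_ : _ = [set k | i < k /\ s k < s i]) //.
  by apply/seteqP; split=> k /= [? ?]; split=> //; lia.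
have ltij : i < j by lia.
rewrite (liftedS r ltij); have [sij|sji|/s_inj e] := ltgtP (s i) (s j).
- rewrite (card_eqI_sub ci cj); last by move=> k [? ?]; split=> //; lia.
  rewrite [window _ _ _](_ : _ = window s (i + 1) (s j) `|` [set i]).
    by apply: card_eqI_setU => //; [exact: card_set1|move=> k [? _] /= ?; lia].
  apply/seteqP; split=> k /=.
    by rewrite /window /= => -[ik kj]; have [->|] := eqVneq k i; [right|left; lia].
  by move=> [[? ?]|->]; split=> //; lia.
- have -> : (r i <= lifted r (i + 1) j)%N = false.
    apply/negbTE; rewrite -ltnNge; apply: (card_eqI_proper (x := j) cj ci).
    + by move=> k [? ?]; split=> //; lia.
    + by split=> //; lia.
    + by case; lia.
  rewrite addn0 [window _ _ _](_ : _ = window s (i + 1) (s j)) //.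
  apply/seteqP; split=> k [ik kj]; split=> //; last lia.
  have [e|] := eqVneq k i; last lia.
  by rewrite e in kj; lia.
- lia.
Qed.

Definition low (s : int -> int) (i v : int) : Prop := forall k : int, k < i -> s k < v.

(** Only finitely many [k <= 0] have a positive value, and only finitely many
    have a value in a given bounded interval. *)
Lemma balanced_low (s : int -> int) : balanced_permutation s ->
  forall v b : int, exists2 i : int, i <= b & low s i v.
Proof.
move=> [s_bij AB fA] v b.
have fB : finite_set [set j : int | j <= 0 /\ 1 <= s j].
  by move: fA; rewrite (eq_finite_set AB).
have fV : finite_set (s @^-1` [set w : int | v <= w /\ w < 1]).
  apply: finite_preimage; first by move=> ? ? _ _; exact: bij_inj.
  by apply: (@bounded_int_finite _ v 1) => k.
have [m mP] := finite_int_bounded fB.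
have [n nP] := finite_int_bounded fV.
exists (Num.min b (Num.min (- `|m|) (- `|n|))); first lia.
move=> k; rewrite !lt_min => /and3P[kb km kn].
rewrite ltNge; apply/negP => vsk; have [sk|sk] := leP 1 (s k).
  by have [] := mP k; [split=> //|]; lia.
by have [] := nP k; [split=> //|]; lia.
Qed.

(** For a low window, moving [i] down adds all the indices passed over, and moving
    [v] up adds the preimages of all the values passed over; so [v - i] minus the
    number of elements of the window is an invariant of [s]. *)
Lemma card_window_extend (s : int -> int) (i i' v v' : int) (n : nat) :
  bijective s -> low s i v -> i' <= i -> v <= v' ->
  (window s i v #= `I_n)%card ->
  (window s i' v' #= `I_(n + `|i - i'| + `|v' - v|))%card.
Proof.
move=> s_bij siv ii' vv' Wn.
have s_inj := bij_inj s_bij; have [t st ts] := s_bij.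
have cV : (t @` [set w : int | v <= w /\ w < v'] #= `I_(`|v' - v|))%card.
  apply: card_eq_trans (card_int_interval vv').
  by apply: inj_card_eq => ? ? _ _; exact: (can_inj ts).
have := card_eqI_setU (card_eqI_setU Wn (card_int_interval ii') _) cV _.
rewrite [X in (X #= _)%card](_ : _ = window s i' v'); first apply.
- by move=> k [? _] [_ ?]; lia.
- move=> k kW [w [vw _] wk]; rewrite -{}wk in kW.
  by case: kW => -[/=]; [|move=> _ /siv]; rewrite ts; lia.
- apply/seteqP; split=> k.
    move=> [[[ik kv]|[ik ki]]|[w [vw wv] <-]]; first by split; lia.
      by split=> //; have := siv _ ki; lia.
    split; rewrite ?ts//; have [//|/lt_le_trans/(_ ii')/siv] := leP i' (t w).
    by rewrite ts; lia.
  move=> [ik kv]; have [sk|sk] := ltP (s k) v; last by right; exists (s k).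
  by left; have [ki|ki] := ltP k i; [right|left].
Qed.

(** With [A] and [B] the two sets of crossings at the origin, the window at value
    [1] satisfies [window + B = A + [i, 1)] as disjoint unions, so that [A] and
    [B] have the same size iff the window has [1 - i] elements. *)
Lemma balance_iff_card_window (s : int -> int) (i : int) (n : nat) :
  i <= 1 -> low s i 1 -> (window s i 1 #= `I_n)%card ->
  (([set j : int | 1%R <= j /\ s j <= 0] #= [set j : int | j <= 0 /\ 1%R <= s j])%card
   /\ finite_set [set j : int | 1 <= j /\ s j <= 0]) <-> i + n%:Z = 1.
Proof.
move=> i1 slow Wn; set A := [set j | _]; set B := [set j | _].
have AW : A `<=` window s i 1 by move=> k [? ?]; split; lia.
have fA : finite_set A := sub_finite_set AW (card_eqI_finite Wn).
have Bi : forall k, B k -> i <= k /\ k < 1.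
  move=> k [k0 sk]; split; last lia.
  by rewrite leNgt; apply/negP => /slow; lia.
have [a Aa] : exists a, (A #= `I_a)%card by apply/finite_setP.
have [b Bb] : exists b, (B #= `I_b)%card.
  by apply/finite_setP; exact: bounded_int_finite Bi.
have e : (n + b = a + `|1 - i|)%N.
  apply: (@card_eqI_inj _ (window s i 1 `|` B)).
    by apply: card_eqI_setU => // k [_ ?] [_ ?]; lia.
  rewrite [window _ _ _ `|` _](_ : _ = A `|` [set k : int | i <= k /\ k < 1]).
    apply: card_eqI_setU => //; first exact: card_int_interval.
    by move=> k [? ?] [? ?]; lia.
  apply/seteqP; split=> k [].
  - move=> [ik sk]; have [k1|k1] := ltP k 1; first by right.
    by left; split; lia.
  - by move=> /Bi; right.
  - by move=> /AW; left.
  - move=> [ik k1]; have [sk|sk] := ltP (s k) 1; first by left.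
    by right; split; lia.
split=> [[AB _]|ien].
  have ab : a = b by apply: card_eqI_inj Aa _; rewrite (card_eql AB).
  lia.
by split=> //; have ab : a = b by [lia]; rewrite (card_eql Aa) card_eq_sym ab.
Qed.

(** Any two low windows are extended to a common one, so the invariant of
    [card_window_extend] vanishes for all of them as soon as it vanishes at value
    [1], where it measures balance. *)
Lemma balanced_card_window (s : int -> int) (i v : int) (n : nat) :
  balanced_permutation s -> low s i v -> (window s i v #= `I_n)%card ->
  i + n%:Z = v.
Proof.
move=> sbal siv Wn; have [s_bij AB fA] := sbal.
have [i0 i01 low0] := balanced_low sbal 1 1.
have [n0 Wn0] : exists n0, (window s i0 1 #= `I_n0)%card.
  apply/finite_setP.
  apply: (@sub_finite_set _ _ ([set j : int | 1 <= j /\ s j <= 0] `|`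
                               [set j : int | i0 <= j /\ j < 1])).
    move=> k [ik sk]; have [k1|k1] := ltP k 1; first by right.
    by left; split; lia.
  rewrite finite_setU; split=> //.
  by apply: (@bounded_int_finite _ i0 1).
have e0 := (balance_iff_card_window i01 low0 Wn0).1 (conj AB fA).
have i'i : Num.min i i0 <= i by lia.
have i'i0 : Num.min i i0 <= i0 by lia.
have vv' : v <= Num.max v 1 by lia.
have v0v' : 1 <= Num.max v 1 by lia.
have := card_eqI_inj (card_window_extend s_bij siv i'i vv' Wn)
          (card_window_extend s_bij low0 i'i0 v0v' Wn0).
lia.
Qed.

(** * Permutations as limits of lifted values *)

(** [s j] is the limit of [i + lifted r i j] as [i] tends to -oo; integer sequences
    converge only by being eventually constant. *)
Definition lifted_limit (s : int -> int) (r : int -> nat) : Prop :=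
  forall j : int, exists2 b : int, b <= j & forall i : int, i <= b -> i + (lifted r i j)%:Z = s j.

Lemma balanced_lifted_limit (s : int -> int) (r : int -> nat) :
  balanced_permutation s -> right_counts s r -> lifted_limit s r.
Proof.
move=> sbal sr j; have [s_bij _ _] := sbal.
have [b bj sb] := balanced_low sbal (s j) j.
exists b => // i ib; apply: (balanced_card_window sbal).
  by move=> k ki; apply: sb; lia.
by apply: card_window_lifted => //; [exact: bij_inj|lia].
Qed.

Lemma lifted_limit_uniq (s t : int -> int) (r : int -> nat) :
  lifted_limit s r -> lifted_limit t r -> s = t.
Proof.
move=> sr tr; apply/funext => j.
have [b _ sb] := sr j; have [c _ tc] := tr j.
by rewrite -(sb (Num.min b c)) ?(tc (Num.min b c)) //; lia.
Qed.

(** Below all the indices counted by [ell], each step to the left lowers [i] by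
    one and raises the lifted value by one. *)
Lemma finite_lifted_limit (r : int -> nat) :
  (forall j : int, finite_set [set i : int | i < j /\ (lifted r i j < r i)%N]) ->
  exists s, lifted_limit s r.
Proof.
move=> fin.
have /choice[b bP] : forall j : int, exists b : int,
    b <= j /\ forall i : int, i < b -> (r i <= lifted r i j)%N.
  move=> j; have [n nP] := finite_int_bounded (fin j).
  exists (Num.min j (- n)); split=> [|i ib]; first lia.
  rewrite leqNgt; apply/negP => lt.
  by have [] := nP i; [split=> //|]; lia.
exists (fun j => b j + (lifted r (b j) j)%:Z) => j; have [bj bP'] := bP j.
exists (b j) => // i.
move: {-2}(`|b j - i|%N) (erefl `|b j - i|%N) => n.
elim: n i => [|n IHn] i en ib; first by have -> : i = b j by lia.
have ij : i < j by lia.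
have ib' : i < b j by lia.
have := bP' _ ib'; rewrite -(IHn (i + 1)); try lia.
by rewrite (lifted_ge r ij) (liftedS r ij) => ->; lia.
Qed.

Section LiftedLimit.
Variables (s : int -> int) (r : int -> nat).
Hypothesis sr : lifted_limit s r.

Lemma lifted_limit_lt (i j k : int) : i <= j -> i <= k ->
  (s j < s k) = (lifted r i j < lifted r i k)%N.
Proof.
move=> ij ik; have [b _ bP] := sr j; have [c _ cP] := sr k.
set m := Num.min i (Num.min b c).
have mi : m <= i by lia.
have mb : m <= b by lia.
have mc : m <= c by lia.
by rewrite -(bP _ mb) -(cP _ mc) ltrD2l ltz_nat (lifted_lt r mi ij ik).
Qed.

Lemma lifted_limit_left_inversion_count (R : realType) (j : int) :
  left_inversion_count R s j = ell R r j.
Proof.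
rewrite ell_counting /left_inversion_count; congr counting.
apply/seteqP; split=> i /= [ij]; split=> //; move: b;
by rewrite (lifted_limit_lt (ltW ij) (lexx i)) lifted_diag.
Qed.

(** Once [i + lifted r i j] is constant, every step to the left raises the lifted
    value, which means that the new index has a smaller image than [j]. *)
Lemma lifted_limit_low (j b : int) : exists2 i : int, i <= b &
  [/\ i <= j, i + (lifted r i j)%:Z = s j & low s i (s j)].
Proof.
have [c cj cP] := sr j; exists (Num.min b c); first lia.
split; [lia|by apply: cP; lia|move=> k kc].
have kj : k < j by lia.
rewrite (lifted_limit_lt (lexx k) (ltW kj)) lifted_diag.
have kc' : k <= c by lia.
have k1c : k + 1 <= c by lia.
have := cP _ kc'; have := cP _ k1c.
by rewrite (liftedS r kj); case: leqP; lia.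
Qed.

Hypothesis zeros : forall i : int, exists2 z : int, i <= z & r z = 0%N.

(** Injectivity is that of the lifted values.  The image is upward closed: a
    larger lifted value than that of [j] at a stage where [j] has stabilised
    belongs to an index that has stabilised too.  It is unbounded below, since
    all sufficiently small indices have an image smaller than a given one. *)
Lemma lifted_limit_bij : bijective s.
Proof.
have s_inj : injective s.
  move=> j k e; have jm : Num.min j k <= j by lia.
  have km : Num.min j k <= k by lia.
  apply: (@lifted_inj r _ _ _ jm km).
  have := lifted_limit_lt jm km; have := lifted_limit_lt km jm.
  by rewrite e ltxx; lia.
have up (j v : int) : s j <= v -> exists k, s k = v.
  move=> jv; have [i _ [ij ej slow]] := lifted_limit_low j j.
  have [k ik ek] := lifted_surj zeros `|v - i|%N i.
  exists k; have jk : (lifted r i j <= lifted r i k)%N by lia.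
  have [b _ bP] := sr k; rewrite -(bP (Num.min b i)); last lia.
  have -> : v = i + (lifted r i k)%:Z by lia.
  have : Num.min b i <= i by lia.
  move: (Num.min b i) => m.
  move: {-2}(`|i - m|%N) (erefl `|i - m|%N) => n.
  (* The order is preserved by the lift, so [k] is raised wherever [j] is. *)
  elim: n m => [|n IHn] m en mi; first by have -> : m = i by lia.
  have mk : m < k by lia.
  have mj : m < j by lia.
  rewrite -(IHn (m + 1)); try lia.
  have mi' : m < i by lia.
  have := slow _ mi'; rewrite (lifted_limit_lt (lexx m) (ltW mj)) lifted_diag.
  have : (lifted r m j <= lifted r m k)%N by rewrite (lifted_le r mi).
  by have := lifted_ge r mk; rewrite (liftedS r mk); case: leqP; lia.
have down n : exists j, s j <= s 0 - n%:Z.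
  elim: n => [|n [j IHj]]; first by exists 0; lia.
  have [i _ [_ _ slow]] := lifted_limit_low j j.
  have i1 : i - 1 < i by lia.
  by exists (i - 1); have := slow _ i1; lia.
have /choice[t st] : forall v : int, exists k : int, s k = v.
  by move=> v; have [j jv] := down `|s 0 - v|%N; apply: (up j); lia.
by exists t => // k; apply: s_inj; rewrite st.
Qed.

Lemma lifted_limit_right_counts : right_counts s r.
Proof.
move=> i.
rewrite [X in (X #= _)%card](_ : _ = [set k | i <= k /\ (lifted r i k < r i)%N]).
  exact: card_lifted.
apply/seteqP; split=> k /= [ik].
  by rewrite (lifted_limit_lt (ltW ik) (lexx i)) lifted_diag => ?; split=> //; lia.
rewrite -{1}(lifted_diag r i) -(lifted_limit_lt ik (lexx i)) => ski; split=> //.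
by rewrite lt_neqAle ik andbT; apply/eqP => e; rewrite e ltxx in ski.
Qed.

(** The window below the index mapped to [1] has as many elements as the lifted
    value of that index, which is the number that balance requires. *)
Lemma lifted_limit_balanced : balanced_permutation s.
Proof.
have s_bij := lifted_limit_bij; have [t _ ts] := s_bij.
have [i i1 [it e slow]] := lifted_limit_low (t 1) 1.
rewrite ts in e slow.
have W : (window s i 1 #= `I_(lifted r i (t 1%R)))%card.
  rewrite [window _ _ _](_ : _ = [set k | i <= k /\ (lifted r i k < lifted r i (t 1))%N]).
    exact: card_lifted.
  apply/seteqP; split=> k /= [ik]; split=> //; move: b;
  by rewrite -(lifted_limit_lt ik it) ts.
by have [AB fA] := (balance_iff_card_window i1 slow W).2 e; split.
Qed.

End LiftedLimit.

(** If [r i] is positive, some [j > i] has [s j < s i]; the right inversions at [j]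
    are then right inversions at [i], and [j] itself is one more. *)
Lemma right_counts_zeros (s : int -> int) (r : int -> nat) :
  right_counts s r -> forall i : int, exists2 z : int, i <= z & r z = 0%N.
Proof.
move=> sr i; move: {2}(r i) (erefl (r i)) => n; elim/ltn_ind: n i => n IHn i rn.
have [r0|r0] := posnP (r i); first by exists i.
have [j [ij sji]] : [set j | i < j /\ s j < s i] !=set0.
  apply/set0P/negP => /eqP e; have := sr i; rewrite e => ri.
  have z0 : ((@set0 int) #= `I_0)%card by rewrite II0.
  by have := card_eqI_inj ri z0; lia.
have [|z jz rz] := IHn (r j) _ j erefl; last by exists z => //; lia.
rewrite -rn; apply: (card_eqI_proper (x := j) (sr j) (sr i)) => //.
  by move=> k [jk skj]; split; lia.
by case; lia.
Qed.

Lemma infinite_zeros (r : int -> nat) :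
  infinite_set [set i : int | 1 <= i /\ r i = 0%N] <->
  forall i : int, exists2 z : int, i <= z & r z = 0%N.
Proof.
split=> [inf i|zeros /finite_int_bounded[n nP]].
  apply: contrapT => noz; apply: inf.
  apply: (@bounded_int_finite _ 1 i) => k [k1 rk]; split=> //.
  by rewrite ltNge; apply/negP => ik; apply: noz; exists k.
have [z zn rz] := zeros (Num.max 1 (n + 1)).
by have [] := nP z; [split=> //|]; lia.
Qed.

Lemma right_inversion_countP (R : realType) (s : int -> int) (r : int -> nat) :
  (forall i, right_inversion_count R s i = (r i)%:R%:E) <-> right_counts s r.
Proof. by split=> sr i; apply/countingE/sr. Qed.

Lemma exists_balanced_lifted_limit (R : realType) (r : int -> nat) :
  (forall i, (ell R r i < +oo)%E) ->
  infinite_set [set i : int | 1 <= i /\ r i = 0%N] ->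
  exists s, [/\ lifted_limit s r, balanced_permutation s & right_counts s r].
Proof.
move=> ell_fin /infinite_zeros zeros.
have [s sr] : exists s, lifted_limit s r.
  by apply: finite_lifted_limit => j; apply/(counting_ltey R); rewrite -ell_counting.
exists s; split=> //; first exact: lifted_limit_balanced.
exact: lifted_limit_right_counts.
Qed.

Theorem theorem7p1 (R : realType) (r : int -> nat) :
  ((exists s : int -> int, balanced_permutation s /\
      forall i : int, right_inversion_count R s i = ((r i)%:R)%:E)
   <->
   ((forall i : int, (ell R r i < +oo)%E) /\
    infinite_set [set i : int | 1 <= i /\ r i = 0%N]))
  /\
  ((forall i : int, (ell R r i < +oo)%E) /\
   infinite_set [set i : int | 1 <= i /\ r i = 0%N] ->
   exists s : int -> int,
     unique (fun t : int -> int => balanced_permutation t /\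
               forall i : int, right_inversion_count R t i = ((r i)%:R)%:E) s
     /\ forall i : int, left_inversion_count R s i = ell R r i).
Proof.
split=> [|[ell_fin inf0]]; last first.
  have [s [slim sbal sr]] := exists_balanced_lifted_limit ell_fin inf0.
  exists s; split; last exact: lifted_limit_left_inversion_count.
  split=> [|t [tbal /right_inversion_countP tr]].
    by split=> //; exact/right_inversion_countP.
  exact: lifted_limit_uniq slim (balanced_lifted_limit tbal tr).
split=> [[s [sbal /right_inversion_countP sr]]|[ell_fin inf0]]; last first.
  have [s [_ sbal sr]] := exists_balanced_lifted_limit ell_fin inf0.
  by exists s; split=> //; exact/right_inversion_countP.
split; last by apply/infinite_zeros; exact: right_counts_zeros sr.
have slim := balanced_lifted_limit sbal sr.
move=> j; rewrite -(lifted_limit_left_inversion_count slim).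
apply/counting_ltey; have [b _ slow] := balanced_low sbal (s j) j.
apply: (@bounded_int_finite _ b j) => k [kj sjk]; split=> //.
by rewrite leNgt; apply/negP => /slow; lia.
Qed.
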